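(* Let $n\ge2$ be an integer. Then $F_n\ge n/(2-\log 2)$.
   Context: For real $x\ge n$ let $\mathcal{A}(x)=\{\mathbf{a}=(a_2,\dots,a_{n+1})\in\mathbb{R}^n:\ 1=a_2\le\cdots\le a_{n+1},\ a_2+\cdots+a_{n+1}=x\}$. For $\mathbf{a}\in\mathcal{A}(x)$ and $2\le k\le n+1$ let $A_k(x,\mathbf{a})=2x-2(n-k+1)-\sum_{i=2}^k a_i$, $F(x,\mathbf{a})=\max_{2\le k\le n+1}A_k(x,\mathbf{a})/a_k$, $F(x)=\min_{\mathbf{a}\in\mathcal{A}(x)}F(x,\mathbf{a})$, and $F_n=\inf_{x\ge n}F(x)$. *)

(* Defs.v *)
From HB Require Import structures.
From mathcomp Require Import all_boot all_order all_algebra.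
From mathcomp Require Import all_classical all_reals all_analysis.
From mathcomp Require Import lra.

Set Implicit Arguments.
Unset Strict Implicit.
Unset Printing Implicit Defensive.

Import Order.TTheory GRing.Theory Num.Theory.
Import numFieldNormedType.Exports.

Local Open Scope classical_set_scope.
Local Open Scope ring_scope.

Section Extrema.
Variable R : realType.
Implicit Types (S : set R) (m : R).

Definition is_max S m := S m /\ ubound S m.
Definition is_min S m := S m /\ lbound S m.

(* The value 0 is returned only when the extremum is not attained; Fxa_max,   *)
(* Fx_min and Fn_has_inf below show that the default values of setmax, setmin *)
(* and inf never occur in Fxa, Fx and Fn for n >= 2 and x >= n.               *)
Definition setmax S : R := xget 0 [set m | is_max S m].
Definition setmin S : R := xget 0 [set m | is_min S m].

End Extrema.

(* A vector (a_2, ..., a_{n+1}) is a row vector indexed by j = 0, ..., n - 1: *)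
(* the entry a 0 j is a_{j+2}, and k = j + 2 gives n - k + 1 = n - j.+1.      *)
Section Functional.
Variables (R : realType) (n : nat).
Implicit Types (x : R) (a : 'rV[R]_n).

Definition calA x : set 'rV[R]_n :=
  [set a | [/\ forall j : 'I_n, j = 0%N :> nat -> a 0 j = 1,
               forall i j : 'I_n, (i <= j)%N -> a 0 i <= a 0 j
             & \sum_(j < n) a 0 j = x]].

Definition Ak x a (j : 'I_n) : R :=
  2 * x - 2 * (n - j.+1)%:R - \sum_(i < n | (i <= j)%N) a 0 i.

Definition Fxa x a : R := setmax [set Ak x a j / a 0 j | j in [set: 'I_n]].

Definition Fx x : R := setmin [set Fxa x a | a in calA x].

Definition Fn : R := inf [set Fx x | x in [set x | n%:R <= x]].

End Functional.

Section WellDefined.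
Variable R : realType.

Lemma is_max_range (n : nat) (r : 'I_n.+1 -> R) :
  is_max [set r j | j in [set: 'I_n.+1]]
         (\big[Num.max/r ord0]_(j < n.+1) r j).
Proof.
split; last by move=> _ [j _ <-]; exact: le_bigmax.
elim/big_ind: _ => [|u v [i _ <-] [j _ <-]|i _]; first by exists ord0.
  by case: (leP (r i) (r j)) => _; [exists j|exists i].
by exists i.
Qed.

Lemma setmaxE (S : set R) m : is_max S m -> setmax S = m.
Proof.
move=> [Sm mub]; apply: xget_unique => // y [Sy yub].
by apply/eqP; rewrite eq_le mub// yub.
Qed.

Lemma FxaE (n : nat) (x : R) (a : 'rV[R]_n.+1) :
  Fxa x a = \big[Num.max/Ak x a ord0 / a 0 ord0]_(j < n.+1) (Ak x a j / a 0 j).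
Proof. exact/setmaxE/(is_max_range (fun j => Ak x a j / a 0 j)). Qed.

Lemma Fxa_max (n : nat) (x : R) (a : 'rV[R]_n) : (0 < n)%N ->
  is_max [set Ak x a j / a 0 j | j in [set: 'I_n]] (Fxa x a).
Proof.
case: n a => [//|n] a _; rewrite FxaE.
exact: (is_max_range (fun j => Ak x a j / a 0 j)).
Qed.

Lemma calA_ge1 (n : nat) (x : R) (a : 'rV[R]_n) :
  calA x a -> forall j, 1 <= a 0 j.
Proof.
case: n a => [|n] a [a0 amon _] j; first by case: j.
by rewrite -(a0 ord0 erefl); exact: amon.
Qed.

Lemma calA_nonempty (n : nat) (x : R) : (2 <= n)%N -> n%:R <= x ->
  @calA R n x !=set0.
Proof.
case: n => [//|n]; rewrite ltnS => n0 nx.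
exists (\row_j (if j == ord_max then x - n%:R else 1)); split.
- by move=> j j0; rewrite mxE -val_eqE /= j0 ltn_eqF.
- move=> i j ij; rewrite !mxE; case: eqP => [ei|_]; case: eqP => [ej|ej] //.
    case: ej; apply/val_inj/eqP; rewrite eqn_leq -ltnS ltn_ord.
    by rewrite -[X in (X <= _)%N]/(val (@ord_max n)) -ei.
  by rewrite lerBrDl natr1.
- rewrite big_ord_recr /= mxE eqxx.
  under eq_bigr => i _.
    rewrite mxE -val_eqE /= ltn_eqF; last exact: ltn_ord.
    over.
  by rewrite sumr_const card_ord addrC subrK.
Qed.

Lemma continuous_coordsum (n : nat) (P : pred 'I_n) :
  continuous (fun a : 'rV[R]_n => \sum_(i < n | P i) a 0 i : R).
Proof.
move=> a; apply: (@cvg_big R^o 'I_n +%R 0 P).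
  exact: (@add_continuous R^o).
  exact: (@nbhs_filter 'rV[R]_n a).
by move=> i _; exact: coord_continuous.
Qed.

Lemma calA_compact (n : nat) (x : R) : compact (@calA R n x).
Proof.
apply: (@subclosed_compact 'rV[R]_n _
  [set v : 'rV[R]_n | forall i, `[1, x]%classic (v ord0 i)]).
- have -> : @calA R n x =
    (\bigcap_(j in [set j : 'I_n | j = 0%N :> nat])
      [set a : 'rV[R]_n | a 0 j = 1]) `&`
    (\bigcap_(p in [set p : 'I_n * 'I_n | (p.1 <= p.2)%N])
      [set a : 'rV[R]_n | 0 <= a 0 p.2 - a 0 p.1]) `&`
    [set a : 'rV[R]_n | \sum_(j < n) a 0 j = x].
    apply/seteqP; split => [a [h1 h2 h3]|a [[h1 h2] h3]].
      split=> //; split=> [j /h1//|p /= /h2]; by rewrite subr_ge0.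
    split=> // i j ij; have := h2 (i, j) ij; by rewrite /= subr_ge0.
  apply: closedI; first apply: closedI.
  + apply: closed_bigI => j _.
    apply: (@preimage_closed _ R^o (fun a : 'rV[R]_n => a 0 j) [set y | y = 1]).
      by move=> a _; exact: coord_continuous.
    exact: closed_eq.
  + apply: closed_bigI => p _.
    apply: (@preimage_closed _ R^o (fun a : 'rV[R]_n => a 0 p.2 - a 0 p.1)
      [set y | 0 <= y]); last exact: closed_ge.
    by move=> a _; apply: (@cvgB _ R^o); [exact: (@nbhs_filter 'rV[R]_n a)
      |exact: coord_continuous..].
  + apply: (@preimage_closed _ R^o (fun a : 'rV[R]_n => \sum_(j < n) a 0 j)
      [set y | y = x]); last exact: closed_eq.
    by move=> a _; exact: continuous_coordsum.
- by apply: (@rV_compact R^o n (fun=> `[1, x]%classic)) => i; exact: segment_compact.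
- move=> a Aa j /=; have a1 := calA_ge1 Aa; rewrite in_itv/= a1/=.
  have [_ _ <-] := Aa.
  by rewrite (bigD1 j)//= lerDl sumr_ge0// => i _; exact: le_trans (a1 i).
Qed.

Lemma Fxa_continuous (n : nat) (x : R) :
  {within @calA R n.+1 x, continuous (fun a => Fxa x a)}.
Proof.
apply: continuous_in_subspaceT => a; rewrite inE => Aa.
have -> : (fun a : 'rV[R]_n.+1 => Fxa x a) = fun a =>
    \big[Num.max/Ak x a ord0 / a 0 ord0]_(j < n.+1) (Ak x a j / a 0 j).
  by apply/funext => b; rewrite FxaE.
have cr j : {for a, continuous
    (fun a : 'rV[R]_n.+1 => Ak x a j / a 0 j : R^o)}.
  apply: (@continuousM R _ (fun a : 'rV[R]_n.+1 => Ak x a j)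
    (fun a : 'rV[R]_n.+1 => (a 0 j)^-1)).
    apply: (@continuousB R R^o _ (fun=> 2 * x - 2 * (n.+1 - j.+1)%:R)
      (fun a : 'rV[R]_n.+1 => \sum_(i < n.+1 | (i <= j)%N) a 0 i)).
      exact: cst_continuous.
    exact: continuous_coordsum.
  apply: (@continuousV R _ (fun a : 'rV[R]_n.+1 => a 0 j)).
    by rewrite gt_eqF// (lt_le_trans ltr01)// (calA_ge1 Aa).
  exact: coord_continuous.
elim: (index_enum _) => [|j s IHs].
  by under [X in continuous_at _ X]eq_fun do rewrite big_nil; exact: cr.
under [X in continuous_at _ X]eq_fun do rewrite big_cons.
exact: (@continuous_max R _ (fun b : 'rV[R]_n.+1 => Ak x b j / b 0 j)
  _ a (cr j) IHs).
Qed.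

Lemma Fx_min (n : nat) (x : R) : (2 <= n)%N -> n%:R <= x ->
  is_min [set Fxa x a | a in @calA R n x] (Fx n x).
Proof.
case: n => [//|n] n2 nx.
have [c cA cmin] := EVT_min_rV (calA_nonempty n2 nx) (@calA_compact n.+1 x)
  (@Fxa_continuous n x).
apply: xgetPex; exists (Fxa x c); split; first by exists c => //; rewrite -inE.
by move=> _ [a Aa <-]; apply: cmin; rewrite inE.
Qed.

Lemma Fn_has_inf (n : nat) : (2 <= n)%N ->
  has_inf [set Fx n x | x in [set x : R | n%:R <= x]].
Proof.
move=> n2; split; first by exists (Fx n n%:R), n%:R => /=.
exists 0 => _ [x /= nx <-]; have [[a Aa <-] _] := Fx_min n2 nx.
case: n n2 nx a Aa => [//|n] n2 nx a Aa.
have [_ /(_ (Ak x a ord0 / a 0 ord0)) h] := Fxa_max x a (ltn0Sn n).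
apply: (@le_trans _ _ (Ak x a ord0 / a 0 ord0)); last by apply: h; exists ord0.
have [a0 _ _] := Aa; rewrite a0// divr1 /Ak.
rewrite (big_pred1 ord0) => [|i]; last by rewrite /= leqn0 -val_eqE.
rewrite a0// subSS subn0; move: nx; rewrite -natr1 => nx; lra.
Qed.

End WellDefined.

(* Main.v *)
Require Import Defs.
From HB Require Import structures.
From mathcomp Require Import all_boot all_order all_algebra.
From mathcomp Require Import all_classical all_reals all_analysis.
From mathcomp Require Import ring lra zify.
Set Implicit Arguments.
Unset Strict Implicit.
Unset Printing Implicit Defensive.
Import Order.TTheory GRing.Theory Num.Theory.
Local Open Scope ring_scope.

(** Fix [a] in [calA x], put [T = Fxa x a] and let [S j] be the sum of the
    first [j] entries of [a].  The inequalities [Ak x a j <= T * a 0 j] say that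
    [E j = S j - 2 * j - 2 * (x - n) + 2 * T] satisfies [q * E j <= E j.+1] with
    [q = T / (T + 1)].  As [S (n - r) >= n - r] and [S n = x], this gives
    [q ^+ r * (2 * T - 2 * x + n + r) <= 2 * T - x] for every [r <= n].
    If [q ^+ r = 1 / 2] held for some [r], then [x] would cancel and leave
    [r <= 2 * T - n]; in general one interpolates between the two consecutive
    exponents whose powers straddle [1 / 2], which still gives
    [T * ln 2 <= 2 * T - n]. *)

Lemma ln2_le1 (R : realType) : ln 2 <= 1 :> R.
Proof. by apply: (@le_ln1Dx R 1); lra. Qed.

Section Contraction.
Variables (R : realType) (T q : R).
Hypotheses (T0 : 0 < T) (qT : q * (T + 1) = T).

Lemma ratio_gt0 : 0 < q.
Proof. by rewrite -(pmulr_lgt0 _ (_ : 0 < T + 1)) ?qT// addr_gt0. Qed.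

(** Since [q * (T + k + 1) <= T + k], the left side is nonincreasing in [k], and it equals [T] at
    [k = 0]. *)
Lemma ratio_exp_bound k : q ^+ k * (T + k%:R) <= T.
Proof.
elim: k => [|k IHk]; first by rewrite expr0 mul1r addr0.
apply: le_trans IHk; rewrite exprSr -mulrA.
rewrite ler_pM2l ?exprn_gt0 ?ratio_gt0// -natr1.
have k0 : 0 <= k%:R :> R by [].
have T1 : 0 < T + 1 by rewrite addr_gt0.
rewrite -(ler_pM2r T1).
have -> : q * (T + (k%:R + 1)) * (T + 1) = q * (T + 1) * (T + (k%:R + 1)).
  by ring.
by rewrite qT; nra.
Qed.

Lemma ratio_exp_le_half k : T <= k%:R -> q ^+ k <= 1 / 2.
Proof.
move=> Tk; have := ratio_exp_bound k.
have qk0 : 0 < q ^+ k by rewrite exprn_gt0// ratio_gt0.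
have : q ^+ k * (T + T) <= q ^+ k * (T + k%:R) by rewrite ler_pM2l// lerD2l.
by move=> h1 /(le_trans h1) h; rewrite -(ler_pM2r T0); lra.
Qed.

(** Write [ln 2 = ln (2 * q ^+ r) + r * ln (1 / q)] and apply [ln (1 + y) <= y] to both logarithms,
    using [1 / q = 1 + 1 / T]. *)
Lemma ln2_le_interpolation r : T * ln 2 <= r%:R + (2 * q ^+ r - 1) * T.
Proof.
have q0 := ratio_gt0; have p0 : 0 < q ^+ r by rewrite exprn_gt0.
have h : ln (2 * q ^+ r) <= 2 * q ^+ r - 1.
  have := @le_ln1Dx R (2 * q ^+ r - 1).
  by rewrite [1 + _]addrC subrK; apply; lra.
move: h; rewrite lnM ?posrE// lnXn//.
have hq : - ln q <= T^-1.
  rewrite -lnV ?posrE//.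
  have -> : q^-1 = 1 + T^-1.
    apply: (mulfI (lt0r_neq0 q0)); rewrite divff ?lt0r_neq0//.
    have -> : q = T / (T + 1) by rewrite -{1}qT mulfK// lt0r_neq0// addr_gt0.
    by field; rewrite !lt0r_neq0// addr_gt0.
  by apply: le_ln1Dx; apply: lt_trans (_ : 0 < _); rewrite ?invr_gt0// ltrN10.
have : - (ln q *+ r) <= T^-1 *+ r by rewrite -mulNrn lerMn2r hq orbT.
move=> h1 h2.
have : ln 2 <= T^-1 *+ r + (2 * q ^+ r - 1) by lra.
rewrite -(ler_pM2l T0) mulrDr mulrnAr divff ?lt0r_neq0//.
by rewrite [T * (_ - _)]mulrC.
Qed.

Lemma ratio_straddle n : T <= n%:R ->
  exists r, [/\ (r < n)%N, 1 / 2 <= q ^+ r & q ^+ r.+1 <= 1 / 2].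
Proof.
move=> Tn; have ex : exists s, q ^+ s <= 1 / 2.
  by exists n; exact: ratio_exp_le_half.
(* The least exponent with power at most [1 / 2] is positive as [q ^+ 0 = 1], and [T <= n] keeps it
   at most [n]. *)
case: (ex_minnP ex) => -[|r] qr rmin; first by move: qr; rewrite expr0; lra.
exists r; split=> //; first by apply: rmin; exact: ratio_exp_le_half.
by rewrite leNgt; apply/negP => /ltW /rmin; rewrite ltnn.
Qed.

End Contraction.

Section PartialSums.
Variables (R : realType) (T q x : R) (n : nat) (S : nat -> R).
Hypotheses (T0 : 0 < T) (qT : q * (T + 1) = T) (Sn : S n = x).
Hypothesis Sge : forall j, (j <= n)%N -> j%:R <= S j.
Hypothesis Sstep : forall j, (j < n)%N ->
  2 * x - 2 * (n - j.+1)%:R - S j.+1 <= T * (S j.+1 - S j).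

(** The affine shift absorbs the inhomogeneous terms of [Sstep]. *)
Let E j := S j - 2 * j%:R - 2 * (x - n%:R) + 2 * T.

Lemma partial_sum_decay r : (r <= n)%N -> q ^+ r * E (n - r) <= E n.
Proof.
elim: r => [|r IHr] rn; first by rewrite expr0 mul1r subn0.
apply: le_trans (IHr (ltnW rn)); rewrite exprSr -mulrA.
rewrite ler_pM2l ?exprn_gt0 ?(ratio_gt0 T0 qT)//.
have /Sstep : (n - r.+1 < n)%N by lia.
have -> : (n - r = (n - r.+1).+1)%N by lia.
have : (n - r.+1 < n)%N by lia.
move: (n - r.+1)%N => j jn; rewrite /E natrB// -natr1 => h.
have T1 : 0 < T + 1 by rewrite addr_gt0.
rewrite -(ler_pM2r T1).
by rewrite mulrAC qT; lra.
Qed.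

Lemma partial_sum_bound r : (r <= n)%N ->
  q ^+ r * (2 * T - 2 * x + n%:R + r%:R) <= 2 * T - x.
Proof.
move=> rn; have -> : 2 * T - x = E n by rewrite /E Sn; lra.
apply: le_trans (partial_sum_decay rn).
rewrite ler_pM2l ?exprn_gt0 ?(ratio_gt0 T0 qT)//.
have := Sge (leq_subr r n); rewrite /E natrB//; lra.
Qed.

Lemma partial_sum_length : n%:R <= T * (2 - ln 2).
Proof.
(* If [n <= T], then [ln 2 <= 1] suffices; otherwise both straddling exponents are at most [n]. *)
have [nT|/ltW Tn] := leP n%:R T.
  apply: (le_trans nT); apply: ler_peMr; first exact: ltW.
  by have := ln2_le1 R; lra.
have [r [rn pge ple]] := ratio_straddle T0 qT Tn.
have h := ln2_le_interpolation T0 qT r.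
have := partial_sum_bound rn; have := partial_sum_bound (ltnW rn).
have q0 := ratio_gt0 T0 qT.
have p'0 : 0 < q ^+ r.+1 by rewrite exprn_gt0.
have pE : q ^+ r * T = q ^+ r.+1 * (T + 1) by rewrite exprSr -mulrA qT.
move: pge ple p'0 pE h; rewrite -[r.+1%:R]natr1.
move: (q ^+ r) (q ^+ r.+1) => p p' pge ple p'0 pE h G1 G2.
suff : r%:R + (2 * p - 1) * T <= 2 * T - n%:R by lra.
(* Weights [1 / 2 - p'] and [p - 1 / 2] make the coefficient of [x] vanish. *)
have w1 : 0 <= 1 / 2 - p' by lra.
have w2 : 0 <= p - 1 / 2 by lra.
have H1 := ler_wpM2l w1 G1; have H2 := ler_wpM2l w2 G2.
(* This is [pE] rearranged. The weights add up to [p - p'], which is therefore positive and can be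
   used to scale the goal. *)
have d : (p - p') * T = p' by lra.
have d0 : 0 < p - p' by rewrite -(pmulr_lgt0 _ T0) d.
rewrite -(ler_pM2l d0).
have -> : (p - p') * (r%:R + (2 * p - 1) * T)
  = (p - p') * r%:R + (2 * p - 1) * ((p - p') * T) by ring.
rewrite d; lra.
Qed.

End PartialSums.

Lemma Fxa_ge (R : realType) (n : nat) (x : R) (a : 'rV[R]_n) :
  (0 < n)%N -> n%:R <= x -> calA x a -> n%:R / (2 - ln 2) <= Fxa x a.
Proof.
move=> n0 nx Aa; have a1 := calA_ge1 Aa; have [a0 _ asum] := Aa.
have [_ ub] := Fxa_max x a n0.
set T := Fxa x a in ub *.
have hT j : Ak x a j <= T * a 0 j.
  by rewrite -ler_pdivrMr ?(lt_le_trans ltr01)//; apply: ub; exists j.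
pose S k := \sum_(i < n | (i < k)%N) a 0 i.
have SS (j : 'I_n) : S j.+1 = S j + a 0 j.
  rewrite /S (bigD1 j)//= addrC; congr (_ + _); apply: eq_bigl => i.
  by rewrite ltnS ltn_neqAle andbC -val_eqE.
have S0 : S 0 = 0 by rewrite /S big_pred0.
have Sn : S n = x by rewrite -asum; apply: eq_bigl => i; rewrite ltn_ord.
(* The first index, whose entry is 1, gives [T >= 2 * (x - n) + 1]. *)
have T0 : 0 < T.
  have := hT (Ordinal n0); rewrite (a0 (Ordinal n0))// mulr1 /Ak.
  have -> : \sum_(i < n | (i <= Ordinal n0)%N) a 0 i = 1.
    by have := SS (Ordinal n0); rewrite a0// S0 add0r.
  apply: lt_le_trans; rewrite natrB//=; lra.
have ln2 : 0 < 2 - ln 2 :> R by have := ln2_le1 R; lra.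
rewrite ler_pdivrMr//.
apply: (@partial_sum_length R T (T / (T + 1)) x n S) => //.
- by rewrite divfK// lt0r_neq0// addr_gt0.
- elim=> [|j IHj] jn; first by rewrite S0.
  by rewrite (SS (Ordinal jn)) -natr1 lerD// IHj// ltnW.
- move=> j jn; have -> : S j.+1 - S j = a 0 (Ordinal jn).
    by rewrite (SS (Ordinal jn)) addrC addKr.
  exact: (hT (Ordinal jn)).
Qed.

Theorem theorem8p1 (R : realType) (n : nat) (hn : (2 <= n)%N) :
  n%:R / (2 - ln 2) <= Fn R n.
Proof.
apply: lb_le_inf; first by have [] := @Fn_has_inf R n hn.
(* By [Fx_min], [Fx n x] is a genuine value [Fxa x a] and not the default of [setmin]. *)
move=> _ [x /= nx <-]; have [[a Aa <-] _] := Fx_min hn nx.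
by apply: Fxa_ge => //; exact: ltnW.
Qed.
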